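(* Let $G(\mathcal{N},\mathcal{E})$ be a connected power network with node set $\mathcal{N}=\{1,\dots,N\}$ and a given active power flow profile, and let $\bm{P}_{\mathrm{C}}=\bm{P}_{\mathrm{N}}-\bm{P}_{\mathrm{B}}\in\mathbb{R}^{N\times N}$ be its carbon flow matrix (as defined in the context). Let $$\mathcal{J}=\Big\{i\in\mathcal{N}\;:\; |\bm{P}_{\mathrm{C}}[i,i]|>\sum_{j=1,\,j\neq i}^{N}|\bm{P}_{\mathrm{C}}[i,j]|\Big\}$$ be the set of indices of the strictly diagonally dominant rows of $\bm{P}_{\mathrm{C}}$. Suppose that for each $i\in\mathcal{N}$ with $i\notin\mathcal{J}$ there is a sequence of nonzero elements of $\bm{P}_{\mathrm{C}}$ of the form $\bm{P}_{\mathrm{C}}[i,i_1],\ \bm{P}_{\mathrm{C}}[i_1,i_2],\ \dots,\ \bm{P}_{\mathrm{C}}[i_r,j]$ with $j\in\mathcal{J}$. Then $\bm{P}_{\mathrm{C}}$ is invertible, and $\bm{P}_{\mathrm{C}}$ is an M-matrix.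
   Context: For a matrix $\bm{A}$, $\bm{A}[i,j]$ denotes the entry in row $i$ and column $j$. Power network: $G(\mathcal{N},\mathcal{E})$ is a connected graph with nodes $\mathcal{N}=\{1,\dots,N\}$ and branches $\mathcal{E}\subset\mathcal{N}\times\mathcal{N}$. In a given active power flow profile, each branch carries power in at most one direction. For each node $i$, $\mathcal{N}_i^{+}$ (resp. $\mathcal{N}_i^{-}$) is the set of neighbor nodes $k\neq i$ that send power to (resp. receive power from) node $i$. For $k\in\mathcal{N}_i^{+}$, $P_{ki}^{i}\ge 0$ is the active power flow on branch $ki$ from $k$ to $i$, measured at the receiving node $i$, and $P_{ki}^{k}$ is the same flow measured at the sending node $k$; they may differ because of the branch power loss $P_{ki}^{\mathrm{loss}}=P_{ki}^{k}-P_{ki}^{i}$. $\mathcal{G}_i$ is the finite set of generators at node $i$, with active power outputs $P_{i,g}^{\mathrm{G}}\ge 0$, and $\mathcal{L}_i$ is the finite set of loads at node $i$, with active powers $P_{i,l}^{\mathrm{L}}$. The flows satisfy the nodal balance $\sum_{k\in\mathcal{N}_i^{+}}P_{ki}^{i}+\sum_{g\in\mathcal{G}_i}P_{i,g}^{\mathrm{G}}=\sum_{j\in\mathcal{N}_i^{-}}P_{ij}^{i}+\sum_{l\in\mathcal{L}_i}P_{i,l}^{\mathrm{L}}$ for all $i\in\mathcal{N}$. Total nodal power inflow: $P_i^{\mathrm{in}}:=\sum_{k\in\mathcal{N}_i^{+}}P_{ki}^{i}+\sum_{g\in\mathcal{G}_i}P_{i,g}^{\mathrm{G}}$. Matrices: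 $\bm{P}_{\mathrm{N}}:=\mathrm{diag}(P_1^{\mathrm{in}},\dots,P_N^{\mathrm{in}})$. The branch power inflow matrix $\bm{P}_{\mathrm{B}}\in\mathbb{R}^{N\times N}$ has $\bm{P}_{\mathrm{B}}[i,k]=P_{ki}^{i}$ and $\bm{P}_{\mathrm{B}}[k,i]=0$ if node $k$ sends power flow $P_{ki}^{i}$ to node $i$ (i.e. $k\in\mathcal{N}_i^{+}$), and all other entries are $0$ (in particular its diagonal is zero). The carbon flow matrix is $\bm{P}_{\mathrm{C}}:=\bm{P}_{\mathrm{N}}-\bm{P}_{\mathrm{B}}$. M-matrix: a real square matrix whose off-diagonal entries are all non-positive and all of whose eigenvalues have positive real part (equivalently, a matrix with non-positive off-diagonal entries that is invertible with entrywise non-negative inverse). *)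

(* Defs.v *)
From HB Require Import structures.
From mathcomp Require Import all_boot all_order all_algebra.
From mathcomp Require Import complex reals.

Set Implicit Arguments.
Unset Strict Implicit.
Unset Printing Implicit Defensive.

Import Order.TTheory GRing.Theory Num.Theory.
Local Open Scope ring_scope.

(* Branches are unordered: a pair in E joins its two ends in both directions. *)
Definition adjacent (N : nat) (E : {set 'I_N * 'I_N}) : rel 'I_N :=
  [rel i k | (i != k) && (((i, k) \in E) || ((k, i) \in E))].

Definition connected_graph (N : nat) (E : {set 'I_N * 'I_N}) : Prop :=
  forall i k : 'I_N, connect (adjacent E) i k.

(* For [sends k i] (node k sends power to node i), the flow on branch ki is
   [received k i] = P_{ki}^i when measured at the receiving node i, and
   [sent k i] = P_{ki}^k when measured at the sending node k; their difference
   is the branch loss.  The values on other pairs are irrelevant. *)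
Record flow_profile (R : realType) (N : nat) (E : {set 'I_N * 'I_N}) :=
  FlowProfile {
    sends : rel 'I_N;
    received : 'I_N -> 'I_N -> R;
    sent : 'I_N -> 'I_N -> R;
    generator : 'I_N -> finType;
    generation : forall i : 'I_N, generator i -> R;
    load : 'I_N -> finType;
    consumption : forall i : 'I_N, load i -> R;
    sends_adjacent : forall k i : 'I_N, sends k i -> adjacent E k i;
    sends_one_way : forall k i : 'I_N, sends k i -> ~~ sends i k;
    received_ge0 : forall k i : 'I_N, sends k i -> 0 <= received k i;
    generation_ge0 :
      forall (i : 'I_N) (g : generator i), 0 <= generation g;
    nodal_balance : forall i : 'I_N,
      \sum_(k < N | sends k i) received k i
        + \sum_(g : generator i) generation g
      = \sum_(j < N | sends i j) sent i j
        + \sum_(l : load i) consumption l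
  }.

Section CarbonFlow.
Variables (R : realType) (N : nat) (E : {set 'I_N * 'I_N}).
Variable F : flow_profile R E.

Definition nodal_inflow (i : 'I_N) : R :=
  \sum_(k < N | sends F k i) received F k i
    + \sum_(g : generator F i) generation g.

Definition node_inflow_matrix : 'M[R]_N := diag_mx (\row_i nodal_inflow i).

(* Row index: receiving node; column index: sending node. *)
Definition branch_inflow_matrix : 'M[R]_N :=
  \matrix_(i < N, k < N) if sends F k i then received F k i else 0.

Definition carbon_flow_matrix : 'M[R]_N :=
  node_inflow_matrix - branch_inflow_matrix.

End CarbonFlow.

Definition strictly_dominant_rows (R : realType) (n : nat) (A : 'M[R]_n) :
    {set 'I_n} :=
  [set i | \sum_(j < n | j != i) `|A i j| < `|A i i|].

(* The eigenvalues are the complex ones, those of A seen as a matrix over R[i]. *)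
Definition M_matrix (R : realType) (n : nat) (A : 'M[R]_n) : Prop :=
  (forall i j : 'I_n, i != j -> A i j <= 0) /\
  (forall z : R[i],
     eigenvalue (map_mx (real_complex R) A) z -> 0 < complex.Re z).

(* Main.v *)
(** A matrix whose rows are all weakly diagonally dominant, and in which every
    row is joined by a chain of nonzero entries to a strictly dominant one, is
    invertible: for a vector v in its kernel, the rows where |v| is maximal force
    |v| to be maximal at every index reached by a nonzero entry, hence at a
    strictly dominant row, where this is impossible.  The rows of the carbon flow
    matrix are weakly dominant with nonnegative diagonal, so subtracting z with
    Re z <= 0 from the diagonal only increases the dominance: no such z, in
    particular not 0, is an eigenvalue. *)

Require Import Defs.
From HB Require Import structures.
From mathcomp Require Import all_boot all_order all_algebra.
From mathcomp Require Import complex reals.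

Set Implicit Arguments.
Unset Strict Implicit.
Unset Printing Implicit Defensive.

Import Order.TTheory GRing.Theory Num.Theory.
Local Open Scope ring_scope.

Section ChainedDominance.
Variables (C : numFieldType) (n : nat).
Implicit Types (M : 'M[C]_n) (v : 'I_n -> C).

(** The kernel equation, maximality of |v i| and dominance close a cycle of inequalities, so all are
    equalities. The first conclusion will exclude strict dominance when v i is nonzero; the second
    carries maximality along nonzero entries. *)
Lemma dominant_row_kernel_max M v (i : 'I_n) :
    \sum_(j < n | j != i) `|M i j| <= `|M i i| ->
    \sum_j M i j * v j = 0 ->
    (forall j, `|v j| <= `|v i|) ->
  `|M i i| * `|v i| = (\sum_(j < n | j != i) `|M i j|) * `|v i| /\
  (forall j, M i j != 0 -> `|v j| = `|v i|).
Proof.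
move=> domi; rewrite (bigD1 i) //= => /eqP; rewrite addr_eq0 => /eqP kerv maxv.
have le1 : `|M i i| * `|v i| <= \sum_(j < n | j != i) `|M i j| * `|v j|.
  rewrite -normrM kerv normrN; apply: le_trans (ler_norm_sum _ _ _) _.
  by apply: ler_sum => j _; rewrite normrM.
have le2 : \sum_(j < n | j != i) `|M i j| * `|v j|
    <= (\sum_(j < n | j != i) `|M i j|) * `|v i|.
  by rewrite mulr_suml; apply: ler_sum => j _; apply: ler_wpM2l.
have le3 : (\sum_(j < n | j != i) `|M i j|) * `|v i| <= `|M i i| * `|v i|.
  by apply: ler_wpM2r.
split; first by apply/le_anti; rewrite le3 (le_trans le1 le2).
(* Equality in [le2], as a vanishing sum of nonnegative terms: each term is zero. *)
have /eqP : \sum_(j < n | j != i) `|M i j| * (`|v i| - `|v j|) = 0.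
  under eq_bigr do rewrite mulrBr.
  rewrite sumrB -mulr_suml; apply/eqP; rewrite subr_eq0; apply/eqP/le_anti.
  by rewrite le2 (le_trans le3 le1).
rewrite psumr_eq0; last by move=> j _; rewrite mulr_ge0 // subr_ge0.
move=> /allP eq0 j Mij; have [->//|ji] := eqVneq j i.
have := eq0 j (mem_index_enum j).
by rewrite ji /= mulf_eq0 normr_eq0 (negPf Mij) subr_eq0 => /eqP.
Qed.

Lemma chained_dominant_unitmx M :
    (forall i, \sum_(j < n | j != i) `|M i j| <= `|M i i|) ->
    (forall i, exists2 p : seq 'I_n, path (fun a b => M a b != 0) i p &
       \sum_(k < n | k != last i p) `|M (last i p) k|
         < `|M (last i p) (last i p)|) ->
  M \in unitmx.
Proof.
(* [det0P] yields a row vector killed from the left; transposing first makes it a right kernel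
   vector of [M], as row dominance requires. *)
move=> dom chainM; rewrite unitmxE unitfE -det_tr; apply/negP => /det0P[v v0 vM].
have kerv i : \sum_j M i j * v 0 j = 0.
  move/matrixP/(_ 0 i): vM; rewrite !mxE => vM; rewrite -[RHS]vM.
  by apply: eq_bigr => j _; rewrite mxE mulrC.
have [i0 vi0] : exists i0, v 0 i0 != 0 by apply/rV0Pn.
have [i maxi] : exists i, forall j, `|v 0 j| <= `|v 0 i|.
  (* The order on [C] is only partial, but norms are real and hence comparable. *)
  have [//|i _|i _ maxi] := @real_arg_maxP _ _ i0 predT (fun j => `|v 0 j|).
    exact: normr_real.
  by exists i => j; apply: maxi.
have vi_gt0 : 0 < `|v 0 i| by apply: lt_le_trans (maxi i0); rewrite normr_gt0.
have [p pathp strict] := chainM i.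
have last_max : `|v 0 (last i p)| = `|v 0 i|.
  suff H a : `|v 0 a| = `|v 0 i| -> path (fun a b => M a b != 0) a p ->
      `|v 0 (last a p)| = `|v 0 i| by exact: H.
  elim: p a {pathp strict} => //= b p IHp a va /andP[Mab]; apply: IHp.
  rewrite -va; apply: (dominant_row_kernel_max (dom a) (kerv a) _).2 => // j.
  by rewrite va maxi.
have [|/eqP eqM _] := dominant_row_kernel_max (dom (last i p)) (kerv _).
  by move=> j; rewrite last_max maxi.
move: eqM; rewrite last_max eq_sym (inj_eq (mulIf (lt0r_neq0 vi_gt0))).
by rewrite lt_eqF.
Qed.

End ChainedDominance.

Section ComplexShift.
Variable R : realType.

Lemma ge0_le_norm_subC (a : R) (z : R[i]) :
  0 <= a -> complex.Re z <= 0 -> (`|a|)%:C%C <= `|a%:C%C - z|.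
Proof.
move=> a0 z0; apply: le_trans (normc_ge_Re _).
rewrite lecR ger0_norm // raddfB /=.
by apply: le_trans (ler_norm _); rewrite lerDl oppr_ge0.
Qed.

(** The shift keeps off-diagonal entries and does not decrease diagonal moduli, so dominance,
    strictness and chains all pass from [A] to the shifted matrix. *)
Lemma chained_dominant_shift_unitmx (n : nat) (A : 'M[R]_n) (z : R[i]) :
    (forall i, 0 <= A i i) ->
    (forall i, \sum_(j < n | j != i) `|A i j| <= `|A i i|) ->
    (forall i, exists2 p : seq 'I_n, path (fun a b => A a b != 0) i p &
       last i p \in strictly_dominant_rows A) ->
    complex.Re z <= 0 ->
  map_mx (real_complex R) A - z%:M \in unitmx.
Proof.
move=> A0 dom chainA z0; set M := _ - _.
have offdiag i j : j != i -> `|M i j| = (`|A i j|)%:C%C.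
  by move=> ji; rewrite !mxE eq_sym (negPf ji) subr0 normc_def /= expr0n addr0 sqrtr_sqr.
have diag i : (`|A i i|)%:C%C <= `|M i i|.
  by rewrite !mxE eqxx; apply: ge0_le_norm_subC.
have rowsum i : \sum_(j < n | j != i) `|M i j|
    = (\sum_(j < n | j != i) `|A i j|)%:C%C.
  by rewrite rmorph_sum; apply: eq_bigr => j; apply: offdiag.
apply: chained_dominant_unitmx => i.
  by rewrite rowsum; apply: le_trans (diag i); rewrite lecR.
have [p pathp strict] := chainA i; exists p.
  apply: sub_path pathp => a b Aab; rewrite -normr_gt0.
  have Aab0 : 0 < (`|A a b|)%:C%C :> R[i] by rewrite ltcR normr_gt0.
  (* A chain may repeat an index, so diagonal entries must stay nonzero too. *)
  have [ba|ba] := eqVneq b a; last by rewrite offdiag.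
  by move: Aab0; rewrite ba => /lt_le_trans; apply.
rewrite rowsum; apply: lt_le_trans (diag _); rewrite ltcR.
by move: strict; rewrite inE.
Qed.

End ComplexShift.

Section CarbonFlowEntries.
Variables (R : realType) (N : nat) (E : {set 'I_N * 'I_N}).
Variable F : flow_profile R E.

Lemma carbon_flow_diag i : carbon_flow_matrix F i i = nodal_inflow F i.
Proof.
rewrite !mxE eqxx mulr1n; case: ifP => [/sends_adjacent|]; last by rewrite subr0.
by rewrite /adjacent /= eqxx.
Qed.

Lemma carbon_flow_offdiag i j : i != j ->
  carbon_flow_matrix F i j = - (if sends F j i then received F j i else 0).
Proof. by move=> ij; rewrite !mxE (negPf ij) sub0r. Qed.

Lemma carbon_flow_offdiag_le0 i j : i != j -> carbon_flow_matrix F i j <= 0.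
Proof.
move=> ij; rewrite carbon_flow_offdiag // oppr_le0.
by case: ifP => // /received_ge0.
Qed.

Lemma nodal_inflow_ge0 i : 0 <= nodal_inflow F i.
Proof.
by rewrite addr_ge0 ?sumr_ge0 // => [k /received_ge0|g _]; rewrite ?generation_ge0.
Qed.

(** The off-diagonal moduli add up to the branch inflow of node i; the diagonal entry exceeds this
    by the local generation, which is nonnegative. *)
Lemma carbon_flow_dominant i :
  \sum_(j < N | j != i) `|carbon_flow_matrix F i j| <= `|carbon_flow_matrix F i i|.
Proof.
rewrite carbon_flow_diag ger0_norm ?nodal_inflow_ge0 //.
rewrite [leRHS]/nodal_inflow -[leLHS]addr0 lerD //; last first.
  by apply: sumr_ge0 => g _; apply: generation_ge0.
rewrite [leLHS]big_mkcond [leRHS]big_mkcond /=; apply: ler_sum => j _.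
have recv0 : 0 <= (if sends F j i then received F j i else 0).
  by case: ifP => // /received_ge0.
case: ifP => // ji.
by rewrite carbon_flow_offdiag 1?eq_sym // normrN ger0_norm.
Qed.

End CarbonFlowEntries.

Theorem theorem1 (R : realType) (N : nat) (E : {set 'I_N * 'I_N})
    (E_connected : connected_graph E) (F : flow_profile R E)
    (chain : forall i : 'I_N,
       i \notin strictly_dominant_rows (carbon_flow_matrix F) ->
       exists (p : seq 'I_N) (j : 'I_N),
         j \in strictly_dominant_rows (carbon_flow_matrix F) /\
         path (fun a b : 'I_N => carbon_flow_matrix F a b != 0) i (rcons p j)) :
  carbon_flow_matrix F \in unitmx /\ M_matrix (carbon_flow_matrix F).
Proof.
set A := carbon_flow_matrix F.
have shift_unit (z : R[i]) : complex.Re z <= 0 ->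
    map_mx (real_complex R) A - z%:M \in unitmx.
  apply: chained_dominant_shift_unitmx => i.
  - by rewrite carbon_flow_diag nodal_inflow_ge0.
  - exact: carbon_flow_dominant.
  have [iJ|/chain[p [j [jJ pathp]]]] := boolP (i \in strictly_dominant_rows A).
    by exists [::].
  by exists (rcons p j); rewrite ?last_rcons.
(* The case z = 0 is invertibility over [R[i]], which descends to [R]. *)
split; first by have := shift_unit 0 (lexx _); rewrite raddf0 subr0 map_unitmx.
split=> [i j|z]; first exact: carbon_flow_offdiag_le0.
case/eigenvalueP => v vA v0; rewrite ltNge; apply/negP => /shift_unit unitA.
have vM : v *m (map_mx (real_complex R) A - z%:M) = 0.
  by rewrite mulmxBr vA mul_mx_scalar subrr.
by case/eqP: v0; rewrite -[v](mulmxK unitA) vM mul0mx.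
Qed.
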